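(* Let $\mathbf K$ be the class of all right-angled Coxeter groups and $\preccurlyeq$ the parabolic subgroup relation on $\mathbf K$. Then $(\mathbf K,\preccurlyeq)$ fails the Smoothness Axiom: there exist $B\in\mathbf K$ and an increasing continuous $\preccurlyeq$-chain $(A_i)_{i<\delta}$ of members of $\mathbf K$ such that $A_i\preccurlyeq B$ for every $i<\delta$ but $\bigcup_{i<\delta}A_i\not\preccurlyeq B$.
   Context: A right-angled Coxeter group is a group $W$ with a presentation whose generating set $S$ (a Coxeter basis, possibly infinite) satisfies only relations $s^2=e$ for $s\in S$ and $(ss')^2=e$ for some pairs of distinct $s,s'\in S$. For right-angled Coxeter groups $A,B$, $A\preccurlyeq B$ (A is a parabolic subgroup of B) iff $A$ is a subgroup of $B$ and there is a Coxeter basis $S$ of $B$ such that $A\cap S$ is a Coxeter basis of $A$ (equivalently $A$ is generated by a subset of $S$). A $\preccurlyeq$-chain $(A_i)_{i<\delta}$ is increasing if $A_i\preccurlyeq A_j$ for $i<j$, and continuous if $A_j=\bigcup_{i<j}A_i$ for limit $j<\delta$. *)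

(* Defs.v *)
From HB Require Import structures.
From mathcomp Require Import all_boot all_order.
From mathcomp Require Import boolp classical_sets.
From mathcomp Require wochoice.

Set Implicit Arguments.
Unset Strict Implicit.
Unset Printing Implicit Defensive.

Local Open Scope classical_set_scope.
Local Open Scope group_scope.

(* A letter (x, false) stands for the generator x, (x, true) for its inverse. *)
Definition gword (T : Type) := seq (T * bool).

Definition geval (G : groupType) (T : Type) (g : T -> G) (w : gword T) : G :=
  \prod_(l <- w) (if l.2 then (g l.1)^-1 else g l.1).

(* Equality of words in the group < T | R >, i.e. in the quotient of the free *)
(* group on T by the normal closure of R.                                     *)
Inductive pres_eq (T : Type) (R : set (gword T)) : gword T -> gword T -> Prop :=
| PresRefl w : pres_eq R w w
| PresSym u v : pres_eq R u v -> pres_eq R v u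
| PresTrans u v w : pres_eq R u v -> pres_eq R v w -> pres_eq R u w
| PresCat u u' v v' :
    pres_eq R u u' -> pres_eq R v v' -> pres_eq R (u ++ v) (u' ++ v')
| PresCancel x b : pres_eq R [:: (x, b); (x, ~~ b)] [::]
| PresRel r : R r -> pres_eq R r [::].

(* The map < T | R > -> G induced by g is well defined and injective, and its *)
(* image is A; in particular A is a subgroup of G.                            *)
Definition presents (G : groupType) (T : Type) (g : T -> G)
    (R : set (gword T)) (A : set G) : Prop :=
  A = range (geval g) /\ (forall w, geval g w = 1 <-> pres_eq R w [::]).

Definition racg_relators (T : Type) (E : T -> T -> Prop) : set (gword T) :=
  [set r | (exists s, r = [:: (s, false); (s, false)]) \/
           (exists s s', [/\ s <> s', E s s' &
              r = [:: (s, false); (s', false); (s, false); (s', false)]])].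

Definition coxeter_basis (G : groupType) (A S : set G) : Prop :=
  exists E : S -> S -> Prop, presents (fun s : S => val s) (racg_relators E) A.

(* Right-angled Coxeter groups are considered as subgroups of an ambient      *)
(* group G; an abstract group G itself is [set: G].                           *)
Definition right_angled_coxeter (G : groupType) (A : set G) : Prop :=
  exists S : set G, coxeter_basis A S.

Definition parabolic (G : groupType) (A B : set G) : Prop :=
  [/\ group_closed (mem A), A `<=` B &
      exists2 S : set G, coxeter_basis B S & coxeter_basis A (A `&` S)].

(* Ordinals are represented by well-ordered types: I plays the role of        *)
(* { i | i < delta }, with delta a nonzero limit ordinal.                     *)
Definition limit_ordinal (d : Order.disp_t) (I : orderType d) : Prop :=
  [/\ wochoice.well_order (<=%O : rel I), (exists i : I, True) &
      forall i : I, exists j : I, (i < j)%O].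

Definition limit_index (d : Order.disp_t) (I : orderType d) (j : I) : Prop :=
  (exists i : I, (i < j)%O) /\
  (forall i : I, (i < j)%O -> exists2 k : I, (i < k)%O & (k < j)%O).

Definition increasing_chain (G : groupType) (d : Order.disp_t)
    (I : orderType d) (A : I -> set G) : Prop :=
  forall i j : I, (i < j)%O -> parabolic (A i) (A j).

Definition continuous_chain (G : groupType) (d : Order.disp_t)
    (I : orderType d) (A : I -> set G) : Prop :=
  forall j : I, limit_index j -> A j = \bigcup_(i in [set i | (i < j)%O]) A i.

(* Main.v *)
From HB Require Import structures.
Require Import Defs.
From mathcomp Require Import fingroup perm.
From mathcomp Require Import all_boot all_order.
From mathcomp Require Import boolp classical_sets.
From mathcomp Require wochoice.

(** Let [B] be the free product of the two-element groups generated by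
    [s 0, s 1, ...], put [a i = s i.+1 * s i * s i.+1], and let [A n] be
    generated by [a 0, ..., a n.-1]. The sequence
    [a 0, ..., a n.-1, s n, s n.+1, ...] is again a Coxeter basis of [B], so
    the [A n] are parabolic in [B] and in each other.

    Their union is proper: let [s i] act on the naturals as the transposition
    of [0] and [i.+1]; every [a i] fixes [0] and [s 0] does not. If the union
    were parabolic, some element [t] of a Coxeter basis of [B] would lie outside
    it. The morphism to Z/2 which is nontrivial only at [t] on that basis
    kills every [a i], hence their conjugates [s i], hence all of [B]:
    contradiction. *)

Set Implicit Arguments.
Unset Strict Implicit.
Unset Printing Implicit Defensive.

(** * Words, their evaluation in a group, and equality derived from relators *)

Section Words.
Local Open Scope classical_set_scope.
Local Open Scope group_scope.

Definition inv_word (T : Type) (w : gword T) : gword T :=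
  rev [seq (l.1, ~~ l.2) | l <- w].

(** The value [None] deletes a letter, so [F] encodes a map of free groups sending each generator to
    a generator or to 1. This covers both relabelling and retraction onto fewer generators. *)
Definition subst_word (T T' : Type) (F : T -> option T') (w : gword T) :
  gword T' := pmap (fun l => omap (fun y => (y, l.2)) (F l.1)) w.

Section Geval.
Variables (G : groupType) (T : Type) (g : T -> G).

Lemma geval_nil : geval g [::] = 1.
Proof. by rewrite /geval big_nil. Qed.

Lemma geval_cons l w :
  geval g (l :: w) = (if l.2 then (g l.1)^-1 else g l.1) * geval g w.
Proof. by rewrite /geval big_cons. Qed.

Lemma geval_letter x : geval g [:: (x, false)] = g x.
Proof. by rewrite geval_cons geval_nil mulg1. Qed.

Lemma geval_cat u v : geval g (u ++ v) = geval g u * geval g v.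
Proof. by rewrite /geval big_cat. Qed.

Lemma geval_inv w : geval g (inv_word w) = (geval g w)^-1.
Proof.
elim: w => [|[x b] w IHw]; first by rewrite geval_nil invg1.
rewrite /inv_word /= rev_cons -cats1 geval_cat -/(inv_word w) IHw.
rewrite !geval_cons geval_nil mulg1 invgM /=.
by case: b; rewrite ?invgK.
Qed.

Lemma geval_mem (A : set G) w :
  group_closed (mem A) -> (forall x, A (g x)) -> A (geval g w).
Proof.
move=> Agrp Ag; elim: w => [|[x b] w /mem_set IHw].
  by rewrite geval_nil; apply: set_mem; case: Agrp.
rewrite geval_cons; apply: set_mem; apply: (group_closedM Agrp) => //=.
have /mem_set Agx := Ag x.
by case: b => //; apply: (group_closedV Agrp).
Qed.

Lemma range_geval_group : group_closed (mem (range (geval g))).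
Proof.
split; first by apply/mem_set; exists [::]; rewrite ?geval_nil.
move=> _ _ /set_mem[u _ <-] /set_mem[v _ <-]; apply/mem_set.
by exists (u ++ inv_word v); rewrite // geval_cat geval_inv.
Qed.

Lemma pres_eq_geval (R : set (gword T)) u v :
  (forall r, R r -> geval g r = 1) -> pres_eq R u v -> geval g u = geval g v.
Proof.
move=> Rg; elim=> //.
- by move=> ? ? ? _ -> _ ->.
- by move=> ? ? ? ? _ IHu _ IHv; rewrite !geval_cat IHu IHv.
- move=> x b; rewrite !geval_cons geval_nil mulg1.
  by case: b; rewrite /= ?mulVg ?mulgV.
- by move=> r Rr; rewrite geval_nil Rg.
Qed.

End Geval.

Lemma morph_one (G H : groupType) (f : G -> H) :
  {morph f : x y / x * y} -> f 1 = 1.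
Proof. by move=> fM; apply: (mulgI (f 1)); rewrite -fM !mulg1. Qed.

Lemma ker_group (G H : groupType) (f : G -> H) :
  {morph f : x y / x * y} -> group_closed (mem [set x | f x = 1]).
Proof.
move=> fM; split; first by apply/mem_set; apply: morph_one.
move=> u v /set_mem/= fu /set_mem/= fv; apply/mem_set => /=.
by rewrite -fu -[in RHS](divgK v u) fM fv mulg1.
Qed.

Lemma morph_geval (G H : groupType) (T : Type) (g : T -> G) (f : G -> H) w :
  {morph f : x y / x * y} -> f (geval g w) = geval (f \o g) w.
Proof.
move=> fM; have f1 := morph_one fM.
have fV x : f x^-1 = (f x)^-1.
  by apply: (mulgI (f x)); rewrite -fM !mulgV.
elim: w => [|[x b] w IHw]; first by rewrite !geval_nil.
by rewrite !geval_cons fM IHw /=; case: b; rewrite ?fV.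
Qed.

Section PresEq.
Variables (T : Type) (R : set (gword T)).

Lemma pres_eq_mulV w : pres_eq R (w ++ inv_word w) [::].
Proof.
elim: w => [|[x b] w IHw]; first exact: PresRefl.
rewrite /inv_word /= rev_cons -cats1 -/(inv_word w) catA.
apply: PresTrans (PresCancel R x b).
apply: (@PresCat _ _ [:: (x, b)] [:: (x, b)] _ [:: (x, ~~ b)]).
  exact: PresRefl.
by apply: (@PresCat _ _ _ [::]) => //; apply: PresRefl.
Qed.

Lemma inv_wordK : involutive (@inv_word T).
Proof.
move=> w; rewrite /inv_word map_rev revK -map_comp -[RHS]map_id.
by apply: eq_map => -[x b] /=; rewrite negbK.
Qed.

Lemma pres_eq_mulVl w : pres_eq R (inv_word w ++ w) [::].
Proof. by have := pres_eq_mulV (inv_word w); rewrite inv_wordK. Qed.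

Lemma pres_eq_inv u v : pres_eq R u v -> pres_eq R (inv_word u) (inv_word v).
Proof.
move=> uv; apply: (@PresTrans _ _ _ (inv_word u ++ (v ++ inv_word v))).
  rewrite -{1}[inv_word u]cats0; apply: PresCat (PresRefl _ _) _.
  exact/PresSym/pres_eq_mulV.
rewrite catA -{2}[inv_word v]cat0s; apply: PresCat (PresRefl _ _).
apply: PresTrans (pres_eq_mulVl u).
exact: PresCat (PresRefl _ _) (PresSym uv).
Qed.

Lemma pres_eq_divP u v : pres_eq R (u ++ inv_word v) [::] -> pres_eq R u v.
Proof.
move=> uv; apply: (@PresTrans _ _ _ (u ++ (inv_word v ++ v))).
  rewrite -{1}[u]cats0; apply: PresCat (PresRefl _ _) _.
  exact/PresSym/pres_eq_mulVl.
by rewrite catA -{2}[v]cat0s; apply: PresCat uv (PresRefl _ _).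
Qed.

Lemma pres_eq_subst (T' : Type) (R' : set (gword T')) (F : T -> option T') u v :
  (forall r, R r -> pres_eq R' (subst_word F r) [::]) ->
  pres_eq R u v -> pres_eq R' (subst_word F u) (subst_word F v).
Proof.
move=> RF; elim=> [w|w w' _|w w' w'' _ IH1 _|w w' x x' _ IH1 _ IH2|x b|r Rr].
- exact: PresRefl.
- exact: PresSym.
- exact: PresTrans.
- by rewrite /subst_word !pmap_cat; apply: PresCat.
- rewrite /subst_word /=; case: (F x) => [y|] /=; last exact: PresRefl.
  exact: PresCancel.
- exact: RF.
Qed.

End PresEq.

Lemma geval_subst (G : groupType) (T T' : Type) (g : T -> G) (g' : T' -> G)
    (F : T -> option T') w :
  (forall x, oapp g' 1 (F x) = g x) -> geval g' (subst_word F w) = geval g w.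
Proof.
move=> Fg; elim: w => [|[x b] w IHw]; first by rewrite !geval_nil.
rewrite geval_cons -IHw /= -Fg /subst_word /=.
by case: (F x) => [y|] /=; rewrite ?geval_cons // invg1 if_same mul1g.
Qed.

Lemma subst_wordK (T T' : Type) (f : T -> T') (F : T' -> option T) w :
  pcancel f F -> subst_word F (subst_word (Some \o f) w) = w.
Proof.
move=> fK; elim: w => [//|[x b] w IHw].
by rewrite /subst_word /= fK /= -/(subst_word _ _) -/(subst_word _ _) IHw.
Qed.

End Words.

(** * Presented groups: universal property and existence *)

Section Presentations.
Local Open Scope classical_set_scope.
Local Open Scope group_scope.

Lemma presents_eq (G : groupType) (T : Type) (g : T -> G) R A u v :
  presents g R A -> geval g u = geval g v -> pres_eq R u v.
Proof.
move=> [_ gR] uv; apply/pres_eq_divP/gR.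
by rewrite geval_cat geval_inv uv mulgV.
Qed.

Lemma presents_relator (G : groupType) (T : Type) (g : T -> G) R A r :
  presents g R A -> R r -> geval g r = 1.
Proof. by move=> [_ gR] Rr; apply/gR/PresRel. Qed.

(** Von Dyck's theorem: [f x] evaluates under [h] a chosen word for [x]. Two words for [x] are
    derivably equal, and [h] respects derivations, so the choice does not matter. *)
Lemma presents_lift (G H : groupType) (T : Type) (g : T -> G) R (h : T -> H) :
  presents g R [set: G] -> (forall r, R r -> geval h r = 1) ->
  exists2 f : G -> H, {morph f : x y / x * y} & forall t, f (g t) = h t.
Proof.
move=> gR Rh; have [gT _] := gR.
have surj x : exists w, geval g w = x.
  by have : [set: G] x by []; rewrite gT => -[w _ <-]; exists w.
pose f x := geval h (projT1 (cid (surj x))).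
have fE w : f (geval g w) = geval h w.
  rewrite /f; case: cid => v /= vw; apply: (pres_eq_geval Rh).
  exact: presents_eq gR vw.
exists f => [x y|t]; last by rewrite -(geval_letter g) fE geval_letter.
have [[u <-] [v <-]] := (surj x, surj y).
by rewrite -geval_cat !fE geval_cat.
Qed.

Section PresentedGroup.
Variables (T : choiceType) (R : set (gword T)).

Let req : rel (gword T) := fun u v => `[< pres_eq R u v >].

Let req_equiv : equiv_class_of req.
Proof.
split=> [w|u v|v u w].
- exact/asboolP/PresRefl.
- by apply/asboolP/asboolP => /PresSym.
- move=> /asboolP uv /asboolP vw; apply/asboolP; exact: PresTrans uv vw.
Qed.

Let req_canon := EquivRelPack req_equiv.
Local Open Scope quotient_scope.
Local Notation Q := {eq_quot req_canon}.

Let pi_eq u v : \pi_Q u = \pi_Q v <-> pres_eq R u v.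
Proof. by split=> [/(eqmodP req_canon)/asboolP|?] //; apply/eqmodP/asboolP. Qed.

Let repr_pi u : pres_eq R (repr (\pi_Q u)) u.
Proof. by apply/pi_eq; rewrite reprK. Qed.

Let mulq (x y : Q) : Q := \pi_Q (repr x ++ repr y).
Let invq (x : Q) : Q := \pi_Q (inv_word (repr x)).

Let mulq_pi u v : mulq (\pi_Q u) (\pi_Q v) = \pi_Q (u ++ v).
Proof. exact/pi_eq/PresCat. Qed.

Let invq_pi u : invq (\pi_Q u) = \pi_Q (inv_word u).
Proof. exact/pi_eq/pres_eq_inv. Qed.

Let mulqA : associative mulq.
Proof.
move=> x y z; apply/pi_eq.
apply: PresTrans (PresCat (PresRefl _ _) (repr_pi _)) _; rewrite catA.
exact/PresSym/(PresCat (repr_pi _))/PresRefl.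
Qed.

Let mul1q : left_id (\pi_Q [::]) mulq.
Proof.
move=> x; rewrite -[RHS]reprK; apply/pi_eq.
exact: PresCat (repr_pi [::]) (PresRefl _ _).
Qed.

Let mulq1 : right_id (\pi_Q [::]) mulq.
Proof.
move=> x; rewrite -[RHS]reprK -[X in _ = \pi X]cats0; apply/pi_eq.
exact: PresCat (PresRefl _ _) (repr_pi [::]).
Qed.

Let mulVq : left_inverse (\pi_Q [::]) invq mulq.
Proof.
move=> x; apply/pi_eq; apply: PresTrans (pres_eq_mulVl _ (repr x)).
exact: PresCat (repr_pi _) (PresRefl _ _).
Qed.

Let mulqV : right_inverse (\pi_Q [::]) invq mulq.
Proof.
move=> x; apply/pi_eq; apply: PresTrans (pres_eq_mulV _ (repr x)).
exact: PresCat (PresRefl _ _) (repr_pi _).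
Qed.

Let Qgroup : groupType :=
  HB.pack Q (isGroup.Build Q mulqA mul1q mulq1 mulVq mulqV).

(** The group consists of words under concatenation modulo [pres_eq R], with inverses induced by
    [inv_word]. *)
Lemma presented_group_exists :
  exists (G : groupType) (g : T -> G), presents g R [set: G].
Proof.
pose g x : Qgroup := \pi_Q [:: (x, false)].
(* Evaluation is the quotient map itself, so a word evaluates to 1 exactly when it is derivably
   trivial. *)
have gE w : geval g w = \pi_Q w.
  elim: w => [|[x b] w IHw]; first by rewrite geval_nil.
  rewrite geval_cons IHw -cat1s -(mulq_pi [:: (x, b)] w); congr (mulq _ _).
  by case: b; rewrite //= [LHS]invq_pi.
exists Qgroup, g; split=> [|w]; last by rewrite gE; apply: pi_eq.
by apply/esym/seteqP; split=> // x _; exists (repr x); rewrite // gE reprK.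
Qed.

End PresentedGroup.
End Presentations.

(** * Coxeter bases: subsets, indexed families and parity morphisms *)

Section CoxeterBases.
Local Open Scope classical_set_scope.
Local Open Scope group_scope.

Definition generated (G : groupType) (U : set G) : set G :=
  range (geval (fun s : U => val s)).

(** With no commuting pairs, the right-angled Coxeter group is a free product of groups of order
    two. *)
Definition no_edge (T : Type) : T -> T -> Prop := fun _ _ => False.

Lemma sub_generated (G : groupType) (U : set G) : U `<=` generated U.
Proof.
move=> x Ux; exists [:: (SigSub (mem_set Ux), false)] => //.
by rewrite geval_letter.
Qed.

Lemma generated_sub (G : groupType) (U A : set G) :
  group_closed (mem A) -> U `<=` A -> generated U `<=` A.
Proof.
move=> Agrp UA _ [w _ <-]; apply: geval_mem => // -[x /= xU].
exact/UA/set_mem.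
Qed.

Lemma generated_group (G : groupType) (U : set G) :
  group_closed (mem (generated U)).
Proof. exact: range_geval_group. Qed.

Lemma coxeter_basis_generated (G : groupType) (A S : set G) :
  coxeter_basis A S -> A = generated S.
Proof. by case=> E []. Qed.

(* Deleting the letters outside [U] maps a relator over [S] to a product of
   relators over [U], so no new relation arises between elements of [U]. *)
Lemma coxeter_basis_sub (G : groupType) (B S U : set G) :
  coxeter_basis B S -> U `<=` S -> coxeter_basis (generated U) U.
Proof.
move=> [E BE] US.
pose incl (u : U) : S := SigSub (mem_set (US _ (set_mem (valP u)))).
pose F (s : S) : option U := insub (val s).
have inclK : pcancel incl F by move=> u; rewrite /F /= valK.
have FP s u : F s = Some u -> s = incl u.
  by rewrite /F; case: insubP => // v _ vs [<-]; apply/val_inj; rewrite /= vs.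
exists (fun u u' => E (incl u) (incl u')); split=> // w.
have geval_incl : geval (fun s : S => val s) (subst_word (Some \o incl) w)
    = geval (fun u : U => val u) w by exact: geval_subst.
split=> [w1|].
  (* Read over [S], the word [w] has a derivation from the relators of [B]; deleting letters by [F]
     brings it back over [U]. *)
  rewrite -(subst_wordK w inclK).
  apply: (@pres_eq_subst _ (racg_relators E) _ _ _ _ [::]); last first.
    by apply: (presents_eq BE); rewrite geval_incl w1 geval_nil.
  move=> r [[s ->]|[s [s' [ss' Ess' ->]]]]; rewrite /subst_word /=.
    case: (F s) => [u|] /=; last exact: PresRefl.
    by apply: PresRel; left; exists u.
  (* If one letter of a commutation relator is deleted, the square of the other letter remains. *)
  case Fs: (F s) => [u|]; case Fs': (F s') => [u'|] /=.
  - move: ss' Ess'; rewrite (FP _ _ Fs) (FP _ _ Fs') => uu' Euu'.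
    apply: PresRel; right; exists u, u'; split=> //.
    by move=> eq_uu'; apply: uu'; rewrite eq_uu'.
  - by apply: PresRel; left; exists u.
  - by apply: PresRel; left; exists u'.
  - exact: PresRefl.
move=> w1; rewrite -(geval_nil (fun u : U => val u)).
apply: pres_eq_geval w1 => r Rr.
rewrite -(@geval_subst _ _ _ _ (fun s : S => val s) (Some \o incl)) //.
apply: (presents_relator BE).
case: Rr => [[u ->]|[u [u' [uu' Euu' ->]]]]; [left|right].
  by exists (incl u).
exists (incl u), (incl u'); split=> // /(congr1 val) /= eq_uu'.
exact/uu'/val_inj.
Qed.

(** The basis demanded by [parabolic] is the intersection of [generated U] with [S]. It lies between
    [U] and [generated U], so it generates the same subgroup, and as a subset of [S] it is a Coxeter
    basis of it. *)
Lemma parabolic_generated (G : groupType) (B S U : set G) :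
  coxeter_basis B S -> U `<=` S -> parabolic (generated U) B.
Proof.
move=> BS US; have Bgen := coxeter_basis_generated BS.
have genUB : generated U `<=` B.
  rewrite Bgen; apply: generated_sub (subset_trans US (@sub_generated _ _)).
  exact: generated_group.
split; [exact: generated_group | by [] | exists S => //].
have genE : generated U = generated (generated U `&` S).
  apply/seteqP; split; apply: generated_sub; try exact: generated_group.
    move=> x Ux; apply: sub_generated.
    by split; [apply: sub_generated | apply: US].
  exact: subIsetl.
rewrite {1}genE; exact: coxeter_basis_sub BS (@subIsetr _ _ _).
Qed.

(** Passes from an indexed family to its set of values: [to] labels each index by its value, [from]
    chooses an index for each value, and the square relators transfer both ways. *)
Lemma coxeter_basis_range (G : groupType) (T : Type) (g : T -> G) A :
  presents g (racg_relators (@no_edge T)) A -> coxeter_basis A (range g).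
Proof.
move=> gA; have [AE _] := gA.
pose to t : range g := SigSub (mem_set (ex_intro2 _ _ t I erefl)).
have from_ex (s : range g) : exists t, g t = val s.
  by have /set_mem[t _ <-] := valP s; exists t.
pose from s := projT1 (cid (from_ex s)).
have gfrom s : g (from s) = val s by rewrite /from; case: cid.
have fromK : cancel from to by move=> s; apply/val_inj; rewrite /= gfrom.
have from_pK : pcancel from (Some \o to) by move=> s /=; rewrite fromK.
have geval_from w : geval g (subst_word (Some \o from) w)
    = geval (fun s : range g => val s) w by apply: geval_subst => s /=.
exists (@no_edge _); split=> [|w].
  rewrite AE; apply/seteqP; split=> _ [w _ <-].
    by exists (subst_word (Some \o to) w) => //; apply: geval_subst.
  by exists (subst_word (Some \o from) w).
split=> [w1|].
  rewrite -(subst_wordK w from_pK).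
  apply: (@pres_eq_subst _ (racg_relators (@no_edge T)) _ _ _ _ [::]).
    move=> r [[t ->]|[? [? []]] //].
    by apply: PresRel; left; exists (to t).
  by apply: (presents_eq gA); rewrite geval_from w1 geval_nil.
move=> w1; rewrite -(geval_nil (fun s : range g => val s)).
apply: pres_eq_geval w1 => r [[s ->]|[? [? []]] //].
rewrite -geval_from; apply: (presents_relator gA); left; by exists (from s).
Qed.

(** Here [{perm bool}] serves as Z/2. Squares are sent to 1; in a commutation relator at least one
    of the two distinct letters is not [t], so its image collapses to a square. *)
Lemma coxeter_basis_parity (G : groupType) (S : set G) (t : G) :
  coxeter_basis [set: G] S -> S t ->
  exists f : G -> {perm bool},
    [/\ {morph f : x y / x * y}, f t <> 1 &
        forall s, S s -> s <> t -> f s = 1].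
Proof.
move=> [E GE] St.
pose h (s : S) : {perm bool} := if val s == t then tperm true false else 1.
have hh s : h s * h s = 1 by rewrite /h; case: eqP; rewrite ?mulg1 ?tperm2.
have [r|f fM fE] := presents_lift GE (h := h).
  case=> [[s ->]|[s [s' [ss' _ ->]]]]; rewrite !geval_cons geval_nil mulg1 //=.
  have : h s = 1 \/ h s' = 1.
    rewrite /h; case: eqP => [st|_]; last by left.
    case: eqP => [s't|_]; last by right.
    by case: ss'; apply: val_inj; rewrite st s't.
  by case=> ->; rewrite !(mul1g, mulg1) hh.
exists f; split=> //.
  rewrite -[t]/(val (SigSub (mem_set St) : S)) fE /h /= eqxx.
  by move=> /perm.permP/(_ true); rewrite tpermL perm1.
move=> s Ss /eqP/negPf st.
by rewrite -[s]/(val (SigSub (mem_set Ss) : S)) fE /h /= st.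
Qed.

Lemma conj_involutive (G : groupType) (x y : G) :
  x * x = 1 -> x * (x * y * x) * x = y.
Proof. by move=> xx; rewrite -!mulgA xx mulg1 mulgA xx mul1g. Qed.

Lemma conj_involution (G : groupType) (x y : G) :
  x * x = 1 -> y * y = 1 -> x * y * x * (x * y * x) = 1.
Proof.
by move=> xx yy; rewrite -!mulgA (mulgA x x) xx mul1g (mulgA y y) yy mul1g.
Qed.

End CoxeterBases.

(** * The twisted bases of the free product and the chain they define *)

Section Example.
Local Open Scope classical_set_scope.
Local Open Scope group_scope.

Variables (B : groupType) (s : nat -> B).
Hypothesis sB : presents s (racg_relators (@no_edge nat)) [set: B].

Let lift (H : groupType) (h : nat -> H) : (forall i, h i * h i = 1) ->
  exists2 f : B -> H, {morph f : x y / x * y} & forall i, f (s i) = h i.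
Proof.
move=> hh; apply: (presents_lift sB) => r [[i ->]|[? [? []]] //].
by rewrite !geval_cons geval_nil mulg1 hh.
Qed.

Let ss i : s i * s i = 1.
Proof.
have := presents_relator sB (r := [:: (i, false); (i, false)]).
by rewrite !geval_cons geval_nil mulg1; apply; left; exists i.
Qed.

Definition twist i := s i.+1 * s i * s i.+1.
Definition twisted_basis n i := if i < n then twist i else s i.
Definition twists n : set B := [set twist i | i in [set i | i < n]].

(* The preimages of the [s i] under the automorphism [s i := twisted_basis n i],
   with [k = n - i]. *)
Fixpoint untwist k i :=
  if k is k'.+1 then untwist k' i.+1 * s i * untwist k' i.+1 else s i.

Let untwist2 k i : untwist k i * untwist k i = 1.
Proof. by elim: k i => //= k IHk i; apply: conj_involution. Qed.

Let twisted_basis2 n i : twisted_basis n i * twisted_basis n i = 1.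
Proof.
by rewrite /twisted_basis; case: ifP => // _; apply: conj_involution.
Qed.

(** Since [f] carries the twisted basis back to [s], its relations are relations among the [s i],
    and conversely by [e]. Since [e] undoes [f] on the [s i], the twisted basis generates. *)
Lemma presents_twisted_basis n :
  presents (twisted_basis n) (racg_relators (@no_edge nat)) [set: B].
Proof.
have [f fM fE] := lift (fun i => untwist2 (n - i) i).
have [e eM eE] := lift (twisted_basis2 n).
have ftb : f \o twisted_basis n = s.
  apply/funext => i /=; rewrite /twisted_basis; case: ltnP => [lt_in|le_ni].
    (* With [U] for [untwist (n - i.+1) i.+1], the image of [twist i] is [U * (U * s i * U) * U]. *)
    by rewrite !fM !fE -[n - i]subnSK //=; apply: conj_involutive.
  by rewrite fE; move: le_ni; rewrite -subn_eq0 => /eqP ->.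
(* For [k = 0] the index is at least [n], where [e] fixes [s i]. Each further step conjugates
   [twist i] by [s i.+1], which returns [s i]. *)
have es k i : n - i = k -> e (untwist k i) = s i.
  elim: k i => [|k IHk] i ni /=; rewrite ?eM eE /twisted_basis.
    by rewrite ltnNge -subn_eq0 ni.
  rewrite -subn_gt0 ni /= IHk ?conj_involutive //.
  by rewrite subnS ni.
have efs : e \o (f \o s) = s by apply/funext => i /=; rewrite fE es.
have [sT sR] := sB.
have tbE w : geval (twisted_basis n) w = e (geval s w).
  by rewrite morph_geval //; congr geval; apply/funext => i /=; rewrite eE.
split=> [|w].
  apply/esym/seteqP; split=> // x _.
  have [w _ <-] : range (geval s) x by rewrite -sT.
  have [v _ vE] : range (geval s) (f (geval s w)) by rewrite -sT.
  by exists v; rewrite // tbE vE !morph_geval // efs.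
rewrite -sR; split=> w1; last by rewrite tbE w1 morph_one.
by rewrite -ftb -morph_geval // w1 morph_one.
Qed.

Lemma coxeter_basis_twisted n :
  coxeter_basis [set: B] (range (twisted_basis n)).
Proof. exact/coxeter_basis_range/presents_twisted_basis. Qed.

Lemma twists_sub_basis n : twists n `<=` range (twisted_basis n).
Proof.
by move=> _ [i /= lt_in <-]; exists i => //; rewrite /twisted_basis lt_in.
Qed.

Lemma coxeter_basis_twists n : coxeter_basis (generated (twists n)) (twists n).
Proof.
exact: coxeter_basis_sub (coxeter_basis_twisted n) (@twists_sub_basis n).
Qed.

Lemma parabolic_twists n : parabolic (generated (twists n)) [set: B].
Proof.
exact: parabolic_generated (coxeter_basis_twisted n) (@twists_sub_basis n).
Qed.

Lemma parabolic_twists_le m n :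
  m <= n -> parabolic (generated (twists m)) (generated (twists n)).
Proof.
move=> le_mn; apply: parabolic_generated (coxeter_basis_twists n) _.
by move=> _ [i /= lt_im <-]; exists i => //=; apply: leq_trans lt_im le_mn.
Qed.

(** Only finitely many generators occur in [twists n], so the action on the naturals can be cut down
    to a finite set: the points moved have index at most [n.+1]. *)
Lemma generator_notin_twists n : ~ generated (twists n) (s 0).
Proof.
(* For [i >= n.+2], [inord i.+1] is [ord0] and [h i] is the identity. *)
pose h i : {perm 'I_n.+3} := tperm ord0 (inord i.+1).
have [f fM fE] := lift (fun i => tperm2 _ _ : h i * h i = 1).
have stab : group_closed (mem [set x | f x ord0 = ord0]).
  split; first by apply/mem_set; rewrite /= morph_one // perm1.
  move=> u v /set_mem/= fu /set_mem/= fv; apply/mem_set => /=.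
  by apply: (@perm_inj _ (f v)); rewrite fv -permM -fM divgK.
have fixes : twists n `<=` [set x | f x ord0 = ord0].
  (* The point 0 goes to [i.+2], which the middle transposition fixes, and then returns to 0. *)
  move=> _ [i /= lt_in <-]; rewrite /twist !fM !fE /h !permM tpermL.
  rewrite (@tpermD _ _ (inord i.+1)) ?tpermR //; apply/eqP => /(congr1 val) /=.
    by rewrite inordK // !ltnS ltnW // ltnW.
  rewrite !inordK ?ltnS //; last by rewrite ltnW // ltnW.
    by move/eqP; rewrite eqn_leq ltnn andbF.
  by rewrite ltnW.
move/(generated_sub stab fixes) => /=; rewrite fE tpermL.
by move/(congr1 val); rewrite /= inordK.
Qed.

Lemma union_twists_not_parabolic :
  ~ parabolic (\bigcup_n generated (twists n)) [set: B].
Proof.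
set A := \bigcup_n _; move=> [Agrp _ [S BS AS]].
(* A basis contained in [A] would make [A] all of [B], but no stage of the chain contains [s 0]. *)
have [t St At] : exists2 t, S t & ~ A t.
  apply: contrapT => noT.
  have SA : S `<=` A.
    by move=> t St; apply: contrapT => At; apply: noT; exists t.
  have [n _] : A (s 0).
    by apply: (generated_sub Agrp SA); rewrite -(coxeter_basis_generated BS).
  exact: generator_notin_twists.
have [f [fM ft fS]] := coxeter_basis_parity BS St.
(* [A] is generated by its elements lying in [S], none of which is [t]. *)
have fA x : A x -> f x = 1.
  rewrite (coxeter_basis_generated AS); apply: (generated_sub (ker_group fM)).
  by move=> y [Ay Sy] /=; apply: fS => // yt; apply: At; rewrite -yt.
(* [twist i] enters the chain at stage [i.+1], and its trivial image is the conjugate of [f (s i)]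
   by [f (s i.+1)]. *)
have fs i : f (s i) = 1.
  have : f (twist i) = 1.
    by apply: fA; exists i.+1 => //; apply: sub_generated; exists i => /=.
  rewrite /twist !fM => fi.
  have f2 : f (s i.+1) * f (s i.+1) = 1 by rewrite -fM ss morph_one.
  by rewrite -(conj_involutive (f (s i)) f2) fi mulg1.
apply: ft; have [sT _] := sB.
have [w _ <-] : range (geval s) t by rewrite -sT.
exact: geval_mem (ker_group fM) fs.
Qed.

End Example.

(** * The naturals as index set, and the conclusion *)

Lemma well_order_nat : wochoice.well_order (<=%O : rel nat).
Proof.
move=> P exP; have [m Pm min_m] := ex_minnP exP.
exists m; split; first by split.
move=> n [Pn min_n]; apply/eqP; rewrite eqn_leq min_m //=.
exact: min_n.
Qed.

(** Every nonzero natural is a successor; continuity of a chain indexed by [nat] is therefore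
    vacuous. *)
Lemma no_limit_index_nat (j : nat) : ~ limit_index j.
Proof.
case: j => [[[]//]|j [_ /(_ j)]].
rewrite ltEnat => /(_ (leqnn _))[k lt_jk].
by move=> /(leq_ltn_trans lt_jk); rewrite ltnn.
Qed.

Local Open Scope classical_set_scope.

Theorem theorem5p1 :
  exists B : groupType, right_angled_coxeter [set: B] /\
  exists (d : Order.disp_t) (I : orderType d) (A : I -> set B),
    limit_ordinal I /\
    (forall i : I, right_angled_coxeter (A i)) /\
    increasing_chain A /\ continuous_chain A /\
    (forall i : I, parabolic (A i) [set: B]) /\
    ~ parabolic (\bigcup_i A i) [set: B].
Proof.
have [B [s sB]] := presented_group_exists (racg_relators (@no_edge nat)).
exists B; split.
  exact: ex_intro (coxeter_basis_range sB).
(* Here delta is omega, and the chain starts from the trivial subgroup. *)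
exists _, nat, (fun n => generated (twists s n)).
split; first split.
- exact: well_order_nat.
- by exists 0.
- by move=> i; exists i.+1; rewrite ltEnat /=.
split; last split; last split; last split.
- by move=> i; exists (twists s i); apply: coxeter_basis_twists.
- by move=> i j /ltnW; apply: parabolic_twists_le.
- by move=> j /no_limit_index_nat.
- exact: parabolic_twists.
- exact: union_twists_not_parabolic.
Qed.
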